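(* Let $Z=(Z_{\mathbf{x},t})_{(\mathbf{x},t)\in D\times\mathcal{T}}$ be a measurable, separable, centred Gaussian process with bounded sample paths whose covariance kernel $k$ satisfies: there exist $C,\alpha_1,\alpha_2>0$ such that for all $\mathbf{x},\mathbf{x}'\in D$ and $t,t'\in\mathcal{T}$, $$k([\mathbf{x},t],[\mathbf{x},t])+k([\mathbf{x}',t'],[\mathbf{x}',t'])-2k([\mathbf{x},t],[\mathbf{x}',t'])\le C\cdot\max\left(\Vert\mathbf{x}-\mathbf{x}'\Vert_\infty^{\alpha_1},\vert t-t'\vert^{\alpha_2}\right).$$ Let $Y=\Psi[Z]$ be the spatial logistic Gaussian process induced by $Z$. Then $Y$ is a field, indexed by $D$, of positive probability density functions on $\mathcal{T}$, and for any $\beta<\frac{\alpha_1}{2}$ (with $\beta>0$), almost surely the map $\mathbf{x}\mapsto Y_{\mathbf{x},\cdot}$ is $\beta$-Hölder continuous with respect to $\Vert\cdot\Vert_\infty$, i.e. almost surely there is a finite (random) constant $L$ with $\Vert Y_{\mathbf{x},\cdot}-Y_{\mathbf{x}',\cdot}\Vert_\infty\le L\Vert\mathbf{x}-\mathbf{x}'\Vert_\infty^{\beta}$ for all $\mathbf{x},\mathbf{x}'\in D$.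
   Context: $(\Omega,\mathcal{F},P)$ is the ambient probability space. $D\subset\mathbb{R}^{d_D}$ ($d_D\ge1$) is compact and convex; $\mathcal{T}\subset\mathbb{R}$ is compact and convex with $\lambda(\mathcal{T})>0$, where $\lambda$ is Lebesgue measure. The spatial logistic density transformation of a measurable $f:D\times\mathcal{T}\to\mathbb{R}$ with $\int_{\mathcal{T}}e^{f(\mathbf{x},u)}\,d\lambda(u)<\infty$ for all $\mathbf{x}\in D$ is $$\Psi[f](\mathbf{x},t)=\frac{e^{f(\mathbf{x},t)}}{\int_{\mathcal{T}}e^{f(\mathbf{x},u)}\,d\lambda(u)},\quad(\mathbf{x},t)\in D\times\mathcal{T}.$$ The spatial logistic Gaussian process induced by $Z$ is $Y_{\mathbf{x},t}=\Psi[Z](\mathbf{x},t)$, applied pathwise. For fixed $\mathbf{x},\mathbf{x}'$, $\Vert Y_{\mathbf{x},\cdot}-Y_{\mathbf{x}',\cdot}\Vert_\infty=\sup_{t\in\mathcal{T}}|Y_{\mathbf{x},t}-Y_{\mathbf{x}',t}|$. *)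

(* Defs.v *)
From HB Require Import structures.
From mathcomp Require Import all_boot all_order all_algebra.
From mathcomp Require Import all_classical all_reals all_analysis.

Set Implicit Arguments.
Unset Strict Implicit.
Unset Printing Implicit Defensive.

Import Order.TTheory GRing.Theory Num.Theory.
Import numFieldNormedType.Exports.

Local Open Scope classical_set_scope.
Local Open Scope ring_scope.

(* R^n with its Borel sigma-algebra. *)
Definition borel_rV (R : realType) (n : nat) :=
  g_sigma_algebraType (@open 'rV[R]_n).

(* N(m, s^2). The case s = 0 is singled out because normal_prob m 0 is not the
   point mass at m. *)
Definition gaussian_law (R : realType) (m s : R) (A : set R) : \bar R :=
  if s == 0 then dirac m A else normal_prob m s A.

(* A process is a function Z : T -> Omega -> R of which only the restriction
   to the index set I : set T is considered. *)
Section processes.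
Context (R : realType) (d : measure_display) (Omega : measurableType d).
Variable P : probability Omega R.

Definition gaussian_rv (X : Omega -> R) :=
  measurable_fun setT X /\
  exists m s : R, 0 <= s /\
    forall A : set R, measurable A -> P (X @^-1` A) = gaussian_law m s A.

Definition gaussian_process (T : Type) (I : set T) (Z : T -> Omega -> R) :=
  forall (N : nat) (p : 'I_N -> T) (a : 'I_N -> R), (forall j, I (p j)) ->
    gaussian_rv (fun w => \sum_(j < N) a j * Z (p j) w).

Definition centred_process (T : Type) (I : set T) (Z : T -> Omega -> R) :=
  forall p, I p -> 'E_P[Z p]%E = 0%E.

Definition covariance_kernel (T : Type) (Z : T -> Omega -> R) (p q : T) : R :=
  fine (covariance P (Z p) (Z q)).

Definition bounded_paths (T : Type) (I : set T) (Z : T -> Omega -> R) :=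
  forall w : Omega, [bounded Z p w | p in I].

(* Doob's separability, relative to the closed subsets of R: off a null set,
   the path over any relatively open piece of I is constrained by its values
   on a countable dense set S. *)
Definition separable_process (T : topologicalType) (I : set T)
    (Z : T -> Omega -> R) :=
  exists S : set T, [/\ countable S, S `<=` I, I `<=` closure S &
    {ae P, forall w : Omega, forall (U : set T) (B : set R),
      open U -> closed B ->
      (forall p, S p -> U p -> B (Z p w)) ->
      forall p, I p -> U p -> B (Z p w)}].

(* Joint measurability on I * Omega. As measurable_fun is vacuous on a
   nonmeasurable domain, this is meaningful for Borel I only. *)
Definition measurable_process (n : nat) (I : set ('rV[R]_n * R))
    (Z : 'rV[R]_n * R -> Omega -> R) :=
  measurable_fun ((I `*` setT) : set (borel_rV R n * R * Omega)%type)
    (fun q : borel_rV R n * R * Omega => Z q.1 q.2).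

End processes.

(* Psi[f](x, t). Rintegral is fine of the extended real integral, hence the
   denominator is the integral whenever the latter is finite. *)
Definition logistic_density (R : realType) (n : nat) (T : set R)
    (f : 'rV[R]_n * R -> R) (x : 'rV[R]_n) (t : R) : R :=
  expR (f (x, t)) / \int[lebesgue_measure]_(u in T) expR (f (x, u)).

Definition positive_pdf (R : realType) (T : set R) (g : R -> R) :=
  [/\ measurable_fun T g, forall t, T t -> 0 < g t &
      (\int[lebesgue_measure]_(t in T) (g t)%:E = 1)%E].

(* sup_{t in T} |g t|, extended real so that it is +oo when g is unbounded. *)
Definition supnorm (R : realType) (T : set R) (g : R -> R) : \bar R :=
  ereal_sup [set (`|g t|)%:E | t in T].

(* The norm of 'rV[R]_n is the max norm. *)
Definition hoelder_supnorm (R : realType) (n : nat) (D : set 'rV[R]_n)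
    (T : set R) (beta : R) (g : 'rV[R]_n -> R -> R) :=
  exists L : R, forall x x' : 'rV[R]_n, D x -> D x' ->
    (supnorm T (fun t => g x t - g x' t)%R <= (L * `|x - x'| `^ beta)%:E)%E.

(* Main.v *)
Require Import Defs.
From HB Require Import structures.
From mathcomp Require Import all_boot all_order all_algebra.
From mathcomp Require Import all_classical all_reals all_analysis.
From mathcomp Require Import measurable_realfun ring lra.

Set Implicit Arguments.
Unset Strict Implicit.
Unset Printing Implicit Defensive.

Import Order.TTheory GRing.Theory Num.Theory.
Import numFieldNormedType.Exports.

Local Open Scope classical_set_scope.
Local Open Scope ring_scope.

(* The increment of Z between two points at distance at most 2^-k is centred
   Gaussian of variance at most C 2^(-k alpha1), so it exceeds 2^(-k beta) with
   probability at most 4 exp (- c q^k), where q = 2^(alpha1 - 2 beta) > 1. As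
   the index set has 2^-k-nets of only exponential cardinality, Borel-Cantelli
   and chaining give a random Hoelder modulus on a countable separating set,
   which separability extends to the whole index set. Since the paths are
   bounded, exp is Lipschitz on their range and the normalising integrals are
   bounded away from 0, hence Psi preserves the Hoelder bound in x uniformly
   in t. *)

(** * Gaussian tails *)

Section gaussian_tail.
Context {R : realType}.
Implicit Types m s c a : R.

Lemma measurable_gt_dist m a : measurable [set x : R | (a < `|x - m|)%R].
Proof.
rewrite -[X in measurable X]setTI.
have -> : [set x : R | (a < `|x - m|)%R] = (fun x => `|x - m|) @^-1` `]a, +oo[.
  by apply/seteqP; split => x /=; rewrite in_itv/= andbT.
by apply: measurableT_comp => //; exact: measurable_funB.
Qed.

(** On the tail, half of the Gaussian exponent is at most [- (a ^+ 2 / (4 * c))]; the other half is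
    the exponent of the density with doubled variance, whose total mass is at most 1. The factor 2
    absorbs the ratio [Num.sqrt 2] of the two peaks. *)
Lemma normal_prob_tail m s c a : s != 0 -> s ^+ 2 <= c -> 0 <= a ->
  (normal_prob m s [set x | (a < `|x - m|)%R]
   <= (2 * expR (- (a ^+ 2 / (4 * c))))%:E)%E.
Proof.
move=> s0 sc a0.
have s2 : 0 < s ^+ 2 by rewrite exprn_even_gt0.
have c0 : 0 < c by exact: lt_le_trans s2 sc.
pose K := 2 * expR (- (a ^+ 2 / (4 * c))).
pose s' := Num.sqrt 2 * s.
have r2 : Num.sqrt 2 ^+ 2 = 2 :> R by rewrite sqr_sqrtr.
have s'0 : s' != 0 by rewrite mulf_neq0// gt_eqF// sqrtr_gt0.
have s'2 : s' ^+ 2 = 2 * s ^+ 2 by rewrite exprMn r2.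
have mA := measurable_gt_dist m a.
have pdf_le x : a < `|x - m| -> normal_pdf m s x <= K * normal_pdf m s' x.
  move=> ax; rewrite /normal_pdf (negbTE s0) (negbTE s'0) /normal_peak /normal_fun.
  rewrite s'2.
  have -> : Num.sqrt (2 * s ^+ 2 * pi *+ 2) =
    Num.sqrt 2 * Num.sqrt (s ^+ 2 * pi *+ 2) :> R.
    by rewrite -sqrtrM//; congr Num.sqrt; ring.
  set q := Num.sqrt (s ^+ 2 * pi *+ 2); set y := x - m in ax *.
  have q0 : 0 <= q^-1 by rewrite invr_ge0 sqrtr_ge0.
  have A2 : - y ^+ 2 / (s ^+ 2 *+ 2) =
      - y ^+ 2 / (2 * s ^+ 2 *+ 2) + - y ^+ 2 / (2 * s ^+ 2 *+ 2) by field.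
  have Ba : - y ^+ 2 / (2 * s ^+ 2 *+ 2) <= - (a ^+ 2 / (4 * c)).
    have -> : 2 * s ^+ 2 *+ 2 = 4 * s ^+ 2 by ring.
    rewrite mulNr lerN2 ler_pM ?sqr_ge0 ?invr_ge0 ?mulr_ge0 ?(ltW c0)//.
      by rewrite -(real_normK (num_real y)) lerXn2r ?nnegrE// ltW.
    by rewrite lef_pV2 ?posrE; lra.
  have r2le : 1 <= 2 / Num.sqrt 2 :> R.
    by rewrite ler_pdivlMr ?sqrtr_gt0// mul1r -(ler_pXn2r (_ : 0 < 2)%N)//
      ?nnegrE ?sqrtr_ge0// r2; lra.
  rewrite A2 expRD.
  have -> : K * ((Num.sqrt 2 * q)^-1 * expR (- y ^+ 2 / (2 * s ^+ 2 *+ 2))) =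
      q^-1 * (expR (- (a ^+ 2 / (4 * c))) * (2 / Num.sqrt 2) *
      expR (- y ^+ 2 / (2 * s ^+ 2 *+ 2))).
    by rewrite /K (invfM (Num.sqrt 2)); ring.
  rewrite ler_wpM2l// ler_wpM2r ?expR_ge0//.
  by rewrite -[leLHS]mulr1 ler_pM ?expR_ge0// ler_expR.
rewrite /normal_prob.
apply: (@le_trans _ _ (\int[lebesgue_measure]_(x in [set x | (a < `|x - m|)%R])
    (K * normal_pdf m s' x)%:E)%E).
  apply: ge0_le_integral => //=.
  - by move=> x _; rewrite lee_fin normal_pdf_ge0.
  - apply/measurable_EFinP; apply: measurable_funTS; exact: measurable_normal_pdf.
  - apply/measurable_EFinP; apply: measurable_funTS.
    by apply: measurable_funM => //; exact: measurable_normal_pdf.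
under eq_integral do rewrite EFinM.
rewrite ge0_integralZl//=; last 3 first.
- apply/measurable_EFinP; apply: measurable_funTS; exact: measurable_normal_pdf.
- by move=> x _; rewrite lee_fin normal_pdf_ge0.
- by rewrite lee_fin mulr_ge0 ?expR_ge0.
rewrite -[leRHS]mule1 lee_wpmul2l ?lee_fin ?mulr_ge0 ?expR_ge0//.
exact: (@probability_le1 _ _ _ (normal_prob m s')).
Qed.

End gaussian_tail.

Section gaussian_law.
Context {R : realType}.
Implicit Types m s c a : R.

Lemma gaussian_law_tail m s c a : 0 < c -> s ^+ 2 <= c -> 0 <= a ->
  (gaussian_law m s [set x | (a < `|x - m|)%R]
   <= (2 * expR (- (a ^+ 2 / (4 * c))))%:E)%E.
Proof.
move=> c0 sc a0; rewrite /gaussian_law; have [_|s0] := eqVneq s 0.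
  rewrite diracE memNset ?lee_fin ?mulr_ge0 ?expR_ge0//=.
  by rewrite subrr normr0; apply/negP; rewrite -leNgt.
exact: normal_prob_tail.
Qed.

(** The density is at most its peak and the interval has length [s]; as pi is at least 2, the peak
    is at most [1 / (2 * s)]. *)
Lemma gaussian_law_small_ball m s : 0 < s ->
  (gaussian_law m s [set x | (`|x| < s / 2)%R] <= (2^-1)%:E)%E.
Proof.
move=> s0; rewrite /gaussian_law gt_eqF// /normal_prob.
have -> : [set x | (`|x| < s / 2)%R] = `]- (s / 2), s / 2[%classic.
  by apply/seteqP; split => x /=; rewrite in_itv/= ltr_norml.
apply: (@le_trans _ _ (\int[lebesgue_measure]_(x in `](- (s / 2))%R, (s / 2)%R[)
    (normal_peak s)%:E)%E).
  apply: ge0_le_integral => //=.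
  - by move=> x _; rewrite lee_fin normal_pdf_ge0.
  - by apply/measurable_EFinP; apply: measurable_funTS; exact: measurable_normal_pdf.
  - by move=> x _; rewrite lee_fin normal_pdf_ub// gt_eqF.
rewrite integral_cst//= lebesgue_measure_itv/= lte_fin.
rewrite (_ : - (s / 2) < s / 2); last by lra.
rewrite -EFinB -EFinM lee_fin opprK -splitr /normal_peak.
set q := Num.sqrt _.
have sq : 2 * s <= q.
  rewrite -[2 * s]ger0_norm; last lra.
  rewrite -sqrtr_sqr ler_wsqrtr// exprMn -[leRHS]mulr_natr -mulrA mulrC.
  by rewrite ler_pM2l ?exprn_gt0//; have := @pi_ge2 R; lra.
rewrite mulrC ler_pdivrMr; lra.
Qed.

End gaussian_law.

Section gaussian_rv.
Context {R : realType} {d : measure_display} {Omega : measurableType d}.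
Variable P : probability Omega R.
Implicit Types (X : Omega -> R) (m s c a U : R).

(** This allows the variance of an increment to be expanded into covariances. By the layer-cake
    formula the second moment about [m] is the integral of the tail of [(X - m) ^+ 2], which decays
    exponentially. *)
Lemma gaussian_rv_Lfun2 X : gaussian_rv P X -> X \in Lfun P 2%:E.
Proof.
move=> [mX [m [s [s0 lawX]]]].
have p1 : 1 <= 2 :> R by rewrite ler1n.
have -> : X = ((fun w => X w - m) : Omega -> R) \+ cst m.
  by apply/funext => w /=; rewrite subrK.
rewrite rpredD ?Lfun_cst//.
have mY : measurable_fun setT (fun w => X w - m) by exact: measurable_funB.
rewrite inE; apply/andP; split; first by rewrite inE.
rewrite inE /= /finite_norm unlock poweR_lty//.
under eq_integral => w _ do
  rewrite /= powR_mulrn// real_normK ?num_real//.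
have mY2 : measurable_fun setT (fun w => (X w - m) ^+ 2) by exact: measurable_funX.
pose Y2 : {RV P >-> R} := mfun_Sub (mem_set mY2).
have -> : (\int[P]_w ((X w - m) ^+ 2)%:E)%E = 'E_P[Y2]%E by rewrite expectation_def.
rewrite ge0_expectation_ccdf; last by move=> w; exact: sqr_ge0.
(* Adding 1 keeps [c] positive in the degenerate case [s = 0]. *)
pose c := s ^+ 2 + 1.
have c0 : 0 < c by rewrite ltr_wpDl// sqr_ge0.
pose r := (4 * c)^-1.
have r0 : 0 < r by rewrite invr_gt0 mulr_gt0.
have mpdf := measurable_exponential_pdf r.
(* The tail bound [2 * expR (- (x / (4 * c)))] is [8 * c] times the exponential density of rate
   [r]. *)
apply: (@le_lt_trans _ _ (\int[lebesgue_measure]_(x in `[0%R, +oo[)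
    ((8 * c)%:E * (exponential_pdf r x)%:E))%E).
  apply: ge0_le_integral => //=.
  - by apply: measurable_funTS; exact: ccdf_measurable.
  - apply/measurable_EFinP/measurable_funTS; exact: measurable_funM.
  move=> x; rewrite in_itv/= andbT => x0.
  rewrite exponential_pdfE//.
  have -> : ccdf Y2 x = P (X @^-1` [set y | Num.sqrt x < `|y - m|]).
    have sqrtE y : (Num.sqrt x < `|y|) = (x < y ^+ 2).
      rewrite -(@ltr_pXn2r _ 2)// ?nnegrE ?sqrtr_ge0//.
      by rewrite sqr_sqrtr// real_normK ?num_real.
    by congr (P _); apply/seteqP; split => w /=; rewrite in_itv/= andbT sqrtE.
  rewrite lawX; last exact: measurable_gt_dist.
  apply: (le_trans (gaussian_law_tail m c0 (_ : s ^+ 2 <= c) (sqrtr_ge0 x))).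
    by rewrite lerDl.
  rewrite sqr_sqrtr// -EFinM lee_fin mulrA mulNr [r * x]mulrC.
  by rewrite /r [8 * c * _](_ : _ = 2)//; field; rewrite gt_eqF.
rewrite ge0_integralZl//=; last 3 first.
- by apply/measurable_EFinP/measurable_funTS.
- by move=> x _; rewrite lee_fin exponential_pdf_ge0// ltW.
- by rewrite lee_fin mulr_ge0// ltW.
rewrite lte_mul_pinfty ?lee_fin ?mulr_ge0 ?ltW//.
rewrite (@le_lt_trans _ _ 1%E) ?ltry//.
exact: (probability_le1 (exponential_prob r)).
Qed.

Lemma chebyshev_centred X a U : measurable_fun setT X -> 'E_P[X]%E = 0%E ->
  ('V_P[X] <= U%:E)%E -> 0 < a ->
  (P [set w | (a <= `|X w|)%R] <= (U / a ^+ 2)%:E)%E.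
Proof.
move=> mX EX0 VU a0.
pose X' : {RV P >-> R} := mfun_Sub (mem_set mX).
have := chebyshev X' a0.
rewrite (_ : 'E_P[X']%E = 0%E)//.
rewrite (_ : [set _ | _] = [set w | a <= `|X w|]); last first.
  by apply/seteqP; split => w /=; rewrite subr0.
move=> /le_trans; apply; rewrite EFinM muleC.
by rewrite lee_wpmul2r// lee_fin invr_ge0 exprn_ge0// ltW.
Qed.

Lemma probability_split (A : set Omega) : measurable A ->
  (1 <= P A + P (~` A))%E.
Proof. by move=> mA; rewrite probability_setC// addeC subeK// fin_num_measure. Qed.

(* Rather than identifying m with the mean and s^2 with the variance, we bound
   them by the variance up to constants: by Chebyshev's inequality half of the
   mass of the law lies within O(sqrt U) of 0, whereas the density bounds put
   mass at least 1/2 outside ]-s/2, s/2[ and within O(s) of m. *)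
Lemma gaussian_rv_tail X U a : gaussian_rv P X -> 'E_P[X]%E = 0%E -> 0 < U ->
  ('V_P[X] <= U%:E)%E -> 0 <= a ->
  (P [set w | (a < `|X w|)%R] <= (4 * expR (- (a ^+ 2 / (2048 * U))))%:E)%E.
Proof.
move=> [mX [m [s [s0 lawX]]]] EX0 U0 VU a0.
have mXi (B : set R) : measurable B -> measurable (X @^-1` B).
  by move=> mB; rewrite -[X in measurable X]setTI; exact: mX.
have mgt : measurable [set x : R | a < `|x|].
  by have := measurable_gt_dist 0 a; under eq_set do rewrite subr0.
(* At least half of the mass lies at distance [s / 2] or more from 0, so Chebyshev's inequality
   gives [1 / 2 <= U / (s / 2) ^+ 2]. *)
have sU : s ^+ 2 <= 8 * U.
  move: s0; rewrite le_eqVlt => /predU1P[<-|s0]; first by rewrite expr0n/= mulr_ge0// ltW.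
  have s20 : 0 < s / 2 by rewrite divr_gt0.
  have mB : measurable [set x : R | `|x| < s / 2].
    have -> : [set x | (`|x| < s / 2)%R] = `]- (s / 2), s / 2[%classic.
      by apply/seteqP; split => x /=; rewrite in_itv/= ltr_norml.
    exact: measurable_itv.
  have := probability_split (mXi _ mB).
  have := gaussian_law_small_ball m s0; rewrite -lawX//.
  have -> : ~` (X @^-1` [set x | `|x| < s / 2]) = [set w | s / 2 <= `|X w|].
    by apply/seteqP; split => w /=; rewrite leNgt => /negP.
  have := chebyshev_centred mX EX0 VU s20.
  move=> h1 h2 h; have := le_trans h (leeD h2 h1); rewrite -EFinD lee_fin.
  rewrite -lerBlDl ler_pdivlMr ?exprn_gt0// expr_div_n; lra.
pose c := 8 * U.
have c0 : 0 < c by rewrite mulr_gt0.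
have U2048 : 0 < 2048 * U by lra.
(* Otherwise the ball of radius [4 * Num.sqrt c] about [m] stays at distance [|m| / 2] from 0. Its
   complement has mass at most [2 * expR (- 4) <= 2 / 5], and by Chebyshev the ball has mass at most
   1/2: together less than 1. *)
have mU : m ^+ 2 <= 512 * U.
  rewrite leNgt; apply/negP => Um.
  have m0 : 0 < `|m| / 2.
    rewrite divr_gt0// normr_gt0; apply: contraTneq Um => ->.
    by rewrite expr0n/= -leNgt; lra.
  have mB := measurable_gt_dist m (4 * Num.sqrt c).
  have q0 : 0 <= 4 * Num.sqrt c by rewrite mulr_ge0.
  have := probability_split (mXi _ mB).
  have := gaussian_law_tail m c0 sU q0; rewrite -lawX//.
  have qm : 4 * Num.sqrt c <= `|m| / 2.
    rewrite -(@ler_pXn2r _ 2)// ?nnegrE ?(ltW m0)// exprMn sqr_sqrtr ?ltW//.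
    by rewrite expr_div_n real_normK ?num_real// /c; lra.
  have sub : ~` (X @^-1` [set x | 4 * Num.sqrt c < `|x - m|]) `<=`
      [set w | `|m| / 2 <= `|X w|].
    move=> w /= /negP; rewrite -leNgt => h.
    have := ler_normB (X w) (X w - m); rewrite opprB addrC subrK; lra.
  have mS : measurable [set w | `|m| / 2 <= `|X w|].
    rewrite -[X in measurable X]setTI.
    have -> : [set w | `|m| / 2 <= `|X w|] = (fun w => `|X w|) @^-1` `[`|m| / 2, +oo[.
      by apply/seteqP; split => w /=; rewrite in_itv/= andbT.
    exact: measurableT_comp.
  have := chebyshev_centred mX EX0 VU m0 => h1 h2.
  have := le_trans _ h1; move=> /(_ _ (le_measure P _ _ sub)).
  rewrite !inE => /(_ (measurableC (mXi _ mB)) mS) {}h1 h.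
  have := le_trans h (leeD h2 h1); rewrite -EFinD lee_fin.
  have -> : (4 * Num.sqrt c) ^+ 2 / (4 * c) = 4.
    by rewrite exprMn sqr_sqrtr ?ltW//; field; rewrite gt_eqF.
  have e4 : expR (- 4) <= 5^-1 :> R.
    by rewrite expRN lef_pV2 ?posrE ?expR_gt0//; have := expR_ge1Dx (4 : R); lra.
  have : U / (`|m| / 2) ^+ 2 <= 1 / 2.
    rewrite ler_pdivrMr ?exprn_gt0// expr_div_n real_normK ?num_real//; lra.
  lra.
have y0 : 0 <= a ^+ 2 / (2048 * U) := divr_ge0 (sqr_ge0 a) (ltW U2048).
(* For large [a] the mean parameter satisfies [|m| <= a / 2], so the tail about [m] at level [a / 2]
   suffices. For small [a] the claimed bound exceeds 1, because [4 * expR (- y) >= 1] when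
   [y <= 1]. *)
have [aU|aU] := leP (2048 * U) (a ^+ 2).
  have am : `|m| <= a / 2.
    rewrite -(@ler_pXn2r _ 2)// ?nnegrE ?divr_ge0//.
    by rewrite expr_div_n real_normK ?num_real//; lra.
  apply: (@le_trans _ _ (P (X @^-1` [set x | a / 2 < `|x - m|]))).
    apply: le_measure; rewrite ?inE.
    - exact: (mXi _ mgt).
    - exact: (mXi _ (measurable_gt_dist m (a / 2))).
    - by move=> w /= aX; have := ler_normD (X w - m) m; rewrite subrK; lra.
  rewrite lawX; last exact: measurable_gt_dist.
  have a20 : 0 <= a / 2 by rewrite divr_ge0.
  apply: (le_trans (gaussian_law_tail m c0 sU a20)).
  rewrite lee_fin ler_pM ?expR_ge0 ?ler_nat//.
  rewrite ler_expR lerN2 expr_div_n /c.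
  rewrite [leRHS](_ : _ = 16 * (a ^+ 2 / (2048 * U))).
    lra.
  by field; rewrite gt_eqF.
apply: (@le_trans _ _ 1%E).
  exact/probability_le1/(mXi _ mgt).
rewrite lee_fin; set y := a ^+ 2 / _ in y0 *.
have y1 : y <= 1 by rewrite ler_pdivrMr// mul1r ltW.
have -> : - y = 2%:R * (- (y / 2)) by field.
rewrite expRM_natl.
have := expR_ge1Dx (- (y / 2)); set e := expR _ => ey.
have : (1 / 2) ^+ 2 <= e ^+ 2 by rewrite ler_pXn2r ?nnegrE ?expR_ge0//; lra.
rewrite expr_div_n; lra.
Qed.

End gaussian_rv.

(** * Chaining and separability *)

Section chaining.
Context {R : realType} {T : Type}.
Variables (E : nat -> T -> T -> Prop) (b : R).
Hypotheses (E_refl : forall k x, E k x x)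
  (E_sym : forall k x y, E k x y -> E k y x)
  (E_comp : forall k x y z, E k.+1 x y -> E k.+1 y z -> E k x z)
  (b_gt0 : 0 < b) (b_lt1 : b < 1).

Let E_le k x y : E k.+1 x y -> E k x y.
Proof. by move=> /E_comp; apply. Qed.

Variables (S : set T) (V : nat -> set T) (f : T -> R) (m : nat).
Hypotheses (V_net : forall k s, S s -> exists2 u, V k u & E k s u)
  (V_exhausts : forall s, S s -> exists K, forall k, (K <= k)%N -> V k s)
  (f_step : forall k u v, (m <= k)%N -> V k.+1 u \/ V k.+2 u ->
    V k.+1 v \/ V k.+2 v -> E k u v -> `|f u - f v| <= b ^+ k).

Let onemb_gt0 : 0 < 1 - b. Proof. by rewrite subr_gt0. Qed.

(** Replacing [u] by a point of the next net closer to [s] costs [b ^+ k], and the costs sum to a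
    geometric series. The induction is on the number of levels left until [s] itself belongs to the
    nets, so the chain is finite and [f] need not be continuous. *)
Let chain s k u : S s -> (m <= k)%N -> V k.+1 u -> E k.+1 s u ->
  `|f s - f u| <= b ^+ k / (1 - b).
Proof.
move=> Ss; have [K VK] := V_exhausts Ss.
have [j] := ubnPleq (K - k).
elim: j k u => [|j IH] k u.
  rewrite leqn0 subn_eq0 => Kk mk Vu su.
  apply: (@le_trans _ _ (b ^+ k)).
    apply: f_step => //; [left|left|exact: E_le] => //.
    by apply: VK; exact: leqW.
  by rewrite ler_pdivlMr// ler_piMr ?exprn_ge0 ?ltW// ltrBlDr ltrDl.
move=> Kk mk Vu su.
have [v Vv sv] := V_net k.+2 Ss.
have uv : `|f u - f v| <= b ^+ k.
  apply: f_step => //; [by left|by right|].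
  by apply: E_comp (E_le sv); exact: E_sym.
have vs : `|f s - f v| <= b ^+ k.+1 / (1 - b).
  by apply: IH => //; [rewrite subnS -subn1 leq_subLR add1n|exact: leqW].
have -> : b ^+ k / (1 - b) = b ^+ k.+1 / (1 - b) + b ^+ k.
  by rewrite exprS; field; rewrite gt_eqF.
have -> : f s - f u = (f s - f v) - (f u - f v) by ring.
by rewrite (le_trans (ler_normB _ _))// lerD.
Qed.

(** The path runs from [s] to a net point [u], then to a net point [u'] near [s'], then to [s'].
    Relating [u] to [u'] takes two uses of [E_comp], hence the loss of two levels. *)
Lemma chaining s s' k : S s -> S s' -> (m <= k)%N -> E k.+2 s s' ->
  `|f s - f s'| <= 3 * b ^+ k / (1 - b).
Proof.
move=> Ss Ss' mk ss'.
have [u Vu su] := V_net k.+2 Ss; have [u' Vu' su'] := V_net k.+2 Ss'.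
have uu' : `|f u - f u'| <= b ^+ k.
  apply: f_step => //; [by right|by right|].
  apply: (@E_comp _ _ s'); last exact: E_le.
  by apply: E_comp ss'; exact: E_sym.
have b1 : b ^+ k <= b ^+ k / (1 - b).
  by rewrite ler_pdivlMr// ler_piMr ?exprn_ge0 ?ltW// ltrBlDr ltrDl.
have b2 : b ^+ k.+1 / (1 - b) <= b ^+ k / (1 - b).
  by rewrite ler_pM2r ?invr_gt0// exprS ler_piMl ?exprn_ge0 ?ltW.
have h := le_trans (chain Ss (leqW mk) Vu su) b2.
have h' := le_trans (chain Ss' (leqW mk) Vu' su') b2.
have -> : f s - f s' = (f s - f u) + (f u - f u') - (f s' - f u') by ring.
rewrite (le_trans (ler_normB _ _))//.
rewrite (le_trans (lerD (ler_normD _ _) (lexx _)))//.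
rewrite [leRHS](_ : _ = b ^+ k / (1 - b) + b ^+ k / (1 - b) + b ^+ k / (1 - b)).
  by rewrite !lerD// (le_trans uu').
by ring.
Qed.

End chaining.

Section separability.
Context {R : realType} {T : topologicalType}.

(** Separability is applied one variable at a time, with a closed ball as the closed set: first [p]
    is freed while [s'] stays in [S], then [p'] is freed with [p] fixed. The open sets are interiors
    of [E]-neighbourhoods, and two compositions cost two levels. *)
Lemma separable_modulus (E : nat -> T -> T -> Prop) (S I : set T) (f : T -> R)
    (k : nat) (c : R) :
  (forall j x y, E j x y -> E j y x) ->
  (forall j x y z, E j.+1 x y -> E j.+1 y z -> E j x z) ->
  (forall j x, nbhs x (E j x)) ->
  (forall (U : set T) (B : set R), open U -> closed B ->
      (forall p, S p -> U p -> B (f p)) ->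
      forall p, I p -> U p -> B (f p)) ->
  (forall s s', S s -> S s' -> E k s s' -> `|f s - f s'| <= c) ->
  forall p p', I p -> I p' -> E k.+2 p p' -> `|f p - f p'| <= c.
Proof.
move=> E_sym E_comp E_nbhs sepf fS p p' Ip Ip' pp'.
have cball y : closed [set z : R | `|y - z| <= c].
  exact: (@closed_closed_ball_ R R^o).
have inU j x : (E j x)^° x by exact: E_nbhs.
have E_refl j x : E j x x by exact: nbhs_singleton.
have oneside s' : S s' -> (E k.+2 p')^° s' -> `|f s' - f p| <= c.
  move=> Ss' /interior_subset p's'.
  apply: (sepf (E k.+2 p)^° [set z | `|f s' - z| <= c]) => //.
  - exact: open_interior.
  - move=> s Ss /interior_subset ps /=; apply: fS => //.
    have s'p : E k.+1 s' p by apply: (E_comp _ _ p'); exact: E_sym.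
    exact: E_comp s'p (E_comp _ _ _ _ (E_refl _ _) ps).
apply: (sepf (E k.+2 p')^° [set z | `|f p - z| <= c]) => //.
- exact: open_interior.
- by move=> s Ss Us /=; rewrite distrC; exact: oneside.
Qed.

End separability.

(** * Borel-Cantelli along finite sets of pairs *)

Section borel_cantelli.
Context {R : realType} {d : measure_display} {Omega : measurableType d}.
Variable P : probability Omega R.

(** With [j] such that [2 * A <= q ^+ j], the inequality [(y / j) ^ j <= expR y] at [y = q ^+ k / c]
    beats [A ^+ k] and leaves the factor [2^-1 ^+ k]; it also gives the constant [(j * c) ^ j]. *)
Lemma expR_superexponential (A q c : R) : 0 <= A -> 1 < q -> 0 < c ->
  exists2 M, 0 <= M &
    forall k, A ^+ k * expR (- (q ^+ k / c)) <= M * 2^-1 ^+ k.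
Proof.
move=> A0 q1 c0.
have q0 : 0 < q by exact: lt_trans q1.
have [j j0 qj] : exists2 j, (0 < j)%N & 2 * A <= q ^+ j.
  have lnq : 0 < ln q by rewrite ln_gt0.
  have [j /ltW jq] : exists j : nat, 2 * A < j.+1%:R * ln q.
    by exists (Num.truncn (2 * A / ln q)); rewrite -ltr_pdivrMr// truncnS_gt.
  exists j.+1 => //; rewrite -(lnK q0) -expRM_natl.
  by rewrite (le_trans jq)// (le_trans _ (expR_ge1Dx _))// lerDr.
have jc : 0 < j%:R * c by rewrite mulr_gt0// ltr0n.
exists ((j%:R * c) ^+ j); first by rewrite exprn_ge0// ltW.
move=> k; have qk : 0 < q ^+ k by rewrite exprn_gt0.
have eb : (q ^+ k / (j%:R * c)) ^+ j <= expR (q ^+ k / c).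
  have -> : q ^+ k / c = j%:R * (q ^+ k / (j%:R * c)).
    by field; rewrite gt_eqF//= pnatr_eq0 -lt0n.
  rewrite expRM_natl ler_pXn2r ?nnegrE ?expR_ge0 ?divr_ge0 ?ltW//.
  by rewrite (lt_le_trans _ (expR_ge1Dx _))// ltrDr.
rewrite expRN ler_pdivrMr ?expR_gt0//.
apply: (@le_trans _ _ ((j%:R * c) ^+ j * 2^-1 ^+ k * (q ^+ k / (j%:R * c)) ^+ j)); last first.
  by rewrite ler_pM2l// mulr_gt0 ?exprn_gt0 ?invr_gt0.
rewrite [leRHS](_ : _ = (q ^+ j / 2) ^+ k).
  by rewrite lerXn2r ?nnegrE ?divr_ge0 ?exprn_ge0 ?(ltW q0)//; lra.
rewrite !expr_div_n exprAC exprVn; field.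
by rewrite !expf_neq0 ?gt_eqF// ltr0n.
Qed.

Lemma measure_bigsetU_le (I : Type) (r : seq I) (p : pred I)
    (F : I -> set Omega) (e : R) : 0 <= e ->
  (forall i, p i -> measurable (F i) /\ (P (F i) <= e%:E)%E) ->
  (P (\big[setU/set0]_(i <- r | p i) F i) <= ((size r)%:R * e)%:E)%E.
Proof.
move=> e0 Fe; elim: r => [|i r IH]; first by rewrite big_nil measure0 mul0r.
rewrite big_cons /= -natr1 mulrDl mul1r.
have mr : measurable (\big[setU/set0]_(j <- r | p j) F j).
  by apply: bigsetU_measurable => j /Fe[].
case: ifPn => [pi|_]; last by rewrite (le_trans IH)// lee_fin lerDl.
have [mi Pi] := Fe _ pi.
by rewrite (le_trans (measureU2 _ _ _))// addrC EFinD leeD.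
Qed.

(** A union bound over the pairs of [W k] makes the probabilities of a large increment at level [k]
    summable; off the limit superior, only finitely many levels fail. *)
Lemma borel_cantelli_pairs (T : choiceType) (E : nat -> T -> T -> Prop)
    (W : nat -> seq T) (Z : T -> Omega -> R) (b eps : nat -> R) (M : R) :
  0 <= M -> (forall k, 0 <= eps k) ->
  (forall k, ((size (W k)) ^ 2)%:R * eps k <= M * 2^-1 ^+ k) ->
  (forall k u v, u \in W k -> v \in W k -> E k u v ->
    measurable [set w | b k < `|Z u w - Z v w|] /\
    (P [set w | (b k < `|Z u w - Z v w|)%R] <= (eps k)%:E)%E) ->
  {ae P, forall w, exists m, forall k, (m <= k)%N ->
    forall u v, u \in W k -> v \in W k -> E k u v -> `|Z u w - Z v w| <= b k}.
Proof.
move=> M0 eps0 We ZE.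
pose B k uv := [set w | b k < `|Z uv.1 w - Z uv.2 w|].
pose sel k (uv : T * T) := [&& uv.1 \in W k, uv.2 \in W k & `[< E k uv.1 uv.2 >]].
pose F k := \big[setU/set0]_(uv <- [seq (u, v) | u <- W k, v <- W k] | sel k uv) B k uv.
have FB k uv : sel k uv -> measurable (B k uv) /\ (P (B k uv) <= (eps k)%:E)%E.
  by move=> /and3P[u v /asboolP]; exact: ZE.
have mF k : measurable (F k) by apply: bigsetU_measurable => uv /FB[].
exists (lim_sup_set F); split.
- by apply: bigcap_measurable => // k _; apply: bigcup_measurable.
- apply: lim_sup_set_cvg0 => //.
  (* The summand [M * 2^-1 ^+ k] is rewritten with [2 ^ k.+1] to match [epsilon_trick0]. *)
  apply: (@le_lt_trans _ _ (\sum_(k <oo) ((2 * M) / (2 ^ k.+1)%:R)%:E)%E); last first.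
    by rewrite (le_lt_trans (epsilon_trick0 _ _)) ?ltry// mulr_ge0.
  apply: lee_nneseries => [k _ _|k _]; first exact: measure_ge0.
  apply: (le_trans (measure_bigsetU_le _ (eps0 k) (FB k))).
  rewrite size_allpairs mulnn lee_fin (le_trans (We k))//.
  by rewrite expnS natrM invfM mulrACA divff// mul1r exprVn natrX.
- move=> w /= h; apply: contrapT => nlim; apply: h.
  have [m wm] : exists m, forall k, (m <= k)%N -> ~ F k w.
    apply: contrapT => /forallNP hm; apply: nlim => m _.
    have /existsNP[k /not_implyP[mk /contrapT Fk]] := hm m.
    by exists k.
  exists m => k mk u v uW vW uv; rewrite leNgt; apply/negP => bZ.
  apply: (wm k mk); rewrite /F -bigcup_seq_cond.
  exists (u, v) => //=; apply/andP; split; first by apply/allpairsP; exists (u, v).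
  by rewrite /sel uW vW; exact/asboolP.
Qed.

End borel_cantelli.

(** * Nets *)

Section aniso_close.
Context {R : realType} {n : nat}.
Variable r : nat.
Implicit Types (k : nat) (p q s : 'rV[R]_n * R).

(* The mesh in the last coordinate is refined r times faster, to compensate for
   a small Hoelder exponent alpha2. *)
Definition aniso_close k p q : Prop :=
  `|p.1 - q.1| <= 2^-1 ^+ k /\ `|p.2 - q.2| <= 2^-1 ^+ (r * k).

Lemma aniso_close_refl k p : aniso_close k p p.
Proof. by rewrite /aniso_close !subrr !normr0; split; rewrite exprn_ge0. Qed.

Lemma aniso_close_sym k p q : aniso_close k p q -> aniso_close k q p.
Proof. by rewrite /aniso_close !(distrC p.1) !(distrC p.2). Qed.

(** From level [k.+1] to [k] the second mesh grows by [2 ^ r], which is at least the factor 2 lost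
    in the triangle inequality only if [r] is positive. *)
Lemma aniso_close_trans k p q s : (0 < r)%N ->
  aniso_close k.+1 p q -> aniso_close k.+1 q s -> aniso_close k p s.
Proof.
move=> r0 [pq1 pq2] [qs1 qs2].
have tri (V : normedZmodType R) (x y z : V) e e' :
    `|x - y| <= e -> `|y - z| <= e -> e + e <= e' -> `|x - z| <= e'.
  by move=> xy yz; apply: le_trans; rewrite (le_trans (ler_distD y _ _))// lerD.
have half : 2^-1 + 2^-1 = 1 :> R by field.
split; [apply: tri pq1 qs1 _|apply: tri pq2 qs2 _].
  by rewrite exprS -mulrDl half mul1r.
rewrite mulnS exprD -mulrDl ler_piMl ?exprn_ge0//.
rewrite -(prednK r0) exprS -mulrDl half mul1r exprn_ile1//.
by rewrite invf_le1// ler1n.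
Qed.

Lemma nbhs_aniso_close k p : nbhs p (aniso_close k p).
Proof.
exists ([set x | `|p.1 - x| < 2^-1 ^+ k], [set t | `|p.2 - t| < 2^-1 ^+ (r * k)]).
  have b0 j : 0 < 2^-1 ^+ j :> R by rewrite exprn_gt0.
  by split => /=; apply/nbhs_ballP;
    [exists (2^-1 ^+ k)|exists (2^-1 ^+ (r * k))] => //= x; rewrite -ball_normE.
by move=> q /= [/ltW ? /ltW ?]; split.
Qed.

Section net.
Variables (I : set ('rV[R]_n * R)) (M : nat).
Hypothesis r_gt0 : (0 < r)%N.
Hypothesis I_bounded : forall p, I p -> `|p.1| <= M%:R /\ `|p.2| <= M%:R.

(** The number of cells of mesh [2^-1 ^+ (r * k)] in [-M, M]; the right endpoint gets the extra code
    [L k]. *)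
Let L k := (2 * M * 2 ^ (r * k))%N.
Let code k (x : R) : 'I_(L k).+1 := inord (Num.truncn ((x + M%:R) * 2 ^+ (r * k))).

Let code_close k x y : `|x| <= M%:R -> `|y| <= M%:R -> code k x = code k y ->
  `|x - y| <= 2^-1 ^+ (r * k).
Proof.
have e0 : 0 < 2 ^+ (r * k) :> R by rewrite exprn_gt0.
(* The range check ensures that [inord] does not fall back on its default value. *)
have bnd (z : R) : `|z| <= M%:R -> [/\ 0 <= (z + M%:R) * 2 ^+ (r * k) &
    (Num.truncn ((z + M%:R) * 2 ^+ (r * k)) < (L k).+1)%N].
  rewrite ler_norml => /andP[z1 z2].
  have z0 : 0 <= z + M%:R by rewrite -lerBlDr sub0r.
  split; first by rewrite mulr_ge0// ltW.
  rewrite ltnS truncn_le_nat; apply: (@le_lt_trans _ _ (L k)%:R); last by rewrite ltr_nat.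
  by rewrite /L 2!natrM natrX ler_pM2r// mulr_natl mulr2n lerD2r.
move=> /bnd[x0 xL] /bnd[y0 yL] /(congr1 val); rewrite /= !inordK// => xy.
move: (truncn_itv x0) (truncn_itv y0); rewrite xy => /andP[x1 x2] /andP[y1 y2].
rewrite exprVn -(ler_pM2r e0) mulVf ?gt_eqF// -(gtr0_norm e0) -normrM.
rewrite mulrBl; move: x1 x2 y1 y2; rewrite -natr1 !mulrDl ler_norml; lra.
Qed.

(** Each code in use is represented by a point of [I] itself, since the process is controlled only
    there; codes not in use get the default [p0]. All coordinates use the finer mesh, which is at
    most [2^-1 ^+ k] because [r] is positive. *)
Lemma net_exists : exists net : nat -> seq ('rV[R]_n * R),
  [/\ forall k u, u \in net k -> I u,
      forall k p, I p -> exists2 u, u \in net k & aniso_close k p u &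
      exists B A : nat, forall k, (size (net k) <= B * A ^ k)%N].
Proof.
have [->|/set0P[p0 Ip0]] := eqVneq I set0.
  by exists (fun=> [::]); split => //; exists 0%N, 0%N.
pose F k : finType := ({ffun 'I_n -> 'I_(L k).+1} * 'I_(L k).+1)%type.
pose cd k (p : 'rV[R]_n * R) : F k := ([ffun i => code k (p.1 ord0 i)], code k p.2).
pose pt k (c : F k) := xget p0 [set p | I p /\ cd k p = c].
have ptI k c : I (pt k c) by rewrite /pt; case: xgetP => [p _ []|].
exists (fun k => [seq pt k c | c : F k]); split.
- by move=> k u /mapP[c _ ->].
- move=> k p Ip; exists (pt k (cd k p)); first by apply: map_f; rewrite mem_enum.
  have [q1 q2] : I (pt k (cd k p)) /\ cd k (pt k (cd k p)) = cd k p.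
    by rewrite /pt; case: xgetP => [q _ //|/(_ p) h]; exfalso; exact: h.
  move: (pt k (cd k p)) q1 q2 => q Iq [qp1 qp2].
  have [p1M p2M] := I_bounded Ip; have [q1M q2M] := I_bounded Iq.
  split; last by apply: code_close.
  have coord (x : 'rV[R]_n) i : `|x| <= M%:R -> `|x ord0 i| <= M%:R.
    by apply: le_trans; rewrite [leRHS]mx_normrE (le_bigmax _ _ (ord0, i)).
  rewrite [leLHS]mx_normrE; apply: bigmax_le; first by rewrite exprn_ge0.
  move=> [j i] _ /=; rewrite !mxE (ord1 j).
  apply: (@le_trans _ _ (2^-1 ^+ (r * k))).
    apply: code_close; rewrite ?coord//.
    by move/ffunP: qp1 => /(_ i); rewrite !ffunE.
  by rewrite ler_wiXn2l ?invr_ge0 ?invf_le1 ?ler1n// leq_pmull.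
- exists ((2 * M).+1 ^ n.+1)%N, (2 ^ (r * n.+1))%N => k.
  rewrite size_map -cardE card_prod card_ffun !card_ord -expnSr.
  rewrite -expnM mulnAC expnM -expnMn leq_exp2r// mulSn /L.
  by rewrite -addn1 addnC leq_add2r expn_gt0.
Qed.

End net.
End aniso_close.

(** * Modulus of continuity of the Gaussian process *)

Section increments.
Context {R : realType} {d : measure_display} {Omega : measurableType d}.
Variables (P : probability Omega R) (T : Type) (I : set T) (Z : T -> Omega -> R).
Hypotheses (Z_gaussian : gaussian_process P I Z) (Z_centred : centred_process P I Z).

Lemma gaussian_process_rv p : I p -> gaussian_rv P (Z p).
Proof.
move=> Ip; have := Z_gaussian (p := fun _ : 'I_1 => p) (fun=> 1) (fun=> Ip).
by under eq_fun do rewrite big_ord1 mul1r.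
Qed.

Lemma gaussian_process_increment p q : I p -> I q ->
  gaussian_rv P (fun w => Z p w - Z q w).
Proof.
move=> Ip Iq.
have := Z_gaussian (p := fun j : 'I_2 => if j == ord0 then p else q)
  (fun j => if j == ord0 then 1 else -1).
under eq_fun do rewrite big_ord_recl big_ord1/= mul1r mulN1r.
by apply => j; case: ifP.
Qed.

Lemma centred_increment p q : I p -> I q ->
  'E_P[fun w => (Z p w - Z q w)%R]%E = 0%E.
Proof.
move=> Ip Iq.
have L1 s : I s -> Z s \in Lfun P 1.
  by move=> /gaussian_process_rv/gaussian_rv_Lfun2/Lfun_subset12; apply;
    exact: fin_num_measure.
by rewrite (expectationB (L1 _ Ip) (L1 _ Iq)) !Z_centred// subee.
Qed.

(** Square integrability makes the covariances finite, so the [fine] in [covariance_kernel] loses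
    nothing. *)
Lemma variance_increment p q : I p -> I q ->
  'V_P[fun w => (Z p w - Z q w)%R]%E =
  (covariance_kernel P Z p p + covariance_kernel P Z q q -
    2 * covariance_kernel P Z p q)%:E.
Proof.
move=> Ip Iq.
have Pfin : P setT \is a fin_num := fin_num_measure P _ measurableT.
have L2 s : I s -> Z s \in Lfun P 2%:E.
  by move=> /gaussian_process_rv/gaussian_rv_Lfun2.
have cov_fin s t : I s -> I t -> covariance P (Z s) (Z t) \is a fin_num.
  by move=> Is It; apply: covariance_fin_num;
    rewrite ?Lfun2_mul_Lfun1 ?Lfun_subset12 ?L2.
rewrite (varianceB (L2 _ Ip) (L2 _ Iq)) /variance /covariance_kernel.
by rewrite -(fineK (cov_fin _ _ Ip Ip)) -(fineK (cov_fin _ _ Iq Iq))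
  -(fineK (cov_fin _ _ Ip Iq)).
Qed.

End increments.

Lemma powR_exprAC {R : realType} (x s : R) k : 0 <= x -> (x ^+ k) `^ s = (x `^ s) ^+ k.
Proof.
by move=> x0; rewrite -(powR_mulrn _ x0) -powRrM mulrC powRrM powR_mulrn ?powR_ge0.
Qed.

Section modulus.
Context {R : realType} {d : measure_display} {Omega : measurableType d}.
Variables (P : probability Omega R) (n : nat) (I : set ('rV[R]_n * R)).
Variable Z : 'rV[R]_n * R -> Omega -> R.
Hypotheses (Z_separable : separable_process P I Z)
  (Z_gaussian : gaussian_process P I Z) (Z_centred : centred_process P I Z).
Variables (C alpha1 alpha2 beta : R) (r M : nat).
Hypotheses (C_gt0 : 0 < C) (alpha1_gt0 : 0 < alpha1) (alpha2_gt0 : 0 < alpha2).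
Hypothesis k_bound : forall p q, I p -> I q ->
  covariance_kernel P Z p p + covariance_kernel P Z q q -
    2 * covariance_kernel P Z p q <=
  C * Num.max (`|p.1 - q.1| `^ alpha1) (`|p.2 - q.2| `^ alpha2).
Hypotheses (beta_gt0 : 0 < beta) (beta_lt : beta < alpha1 / 2).
Hypotheses (r_gt0 : (0 < r)%N) (r_alpha : alpha1 <= r%:R * alpha2).
Hypothesis I_bounded : forall p, I p -> `|p.1| <= M%:R /\ `|p.2| <= M%:R.

(** At level [k] an increment has variance at most [C * a ^+ k] and is compared with [b ^+ k]; up to
    [C], [q ^+ k] is the squared threshold over the variance. *)
Let a : R := 2^-1 `^ alpha1.
Let b : R := 2^-1 `^ beta.
Let q : R := b ^+ 2 / a.

Let half_gt0 : 0 < 2^-1 :> R. Proof. by rewrite invr_gt0. Qed.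

Let a_gt0 : 0 < a. Proof. exact: powR_gt0. Qed.

Let b_gt0 : 0 < b. Proof. exact: powR_gt0. Qed.

Let powR_half_lt s s' : s < s' -> 2^-1 `^ s' < 2^-1 `^ s :> R.
Proof.
move=> ss'; rewrite /powR gt_eqF// ltr_expR ltr_nM2r//.
by apply: ln_lt0; rewrite half_gt0 invf_lt1// ltr1n.
Qed.

Let b_lt1 : b < 1.
Proof. by rewrite /b -[ltRHS](powRr0 2^-1) powR_half_lt. Qed.

Let q_gt1 : 1 < q.
Proof.
rewrite /q ltr_pdivlMr// mul1r -powR_mulrn ?powR_ge0// -powRrM /a powR_half_lt//.
by rewrite -ltr_pdivlMr.
Qed.

Let close_tail k u v : I u -> I v -> aniso_close r k u v ->
  measurable [set w | b ^+ k < `|Z u w - Z v w|] /\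
  (P [set w | (b ^+ k < `|Z u w - Z v w|)%R] <=
    (4 * expR (- (q ^+ k / (2048 * C))))%:E)%E.
Proof.
move=> Iu Iv [uv1 uv2].
have g := gaussian_process_increment Z_gaussian Iu Iv.
split.
  rewrite -[X in measurable X]setTI.
  have -> : [set w | b ^+ k < `|Z u w - Z v w|] =
      (fun w => `|Z u w - Z v w|) @^-1` `]b ^+ k, +oo[.
    by apply/seteqP; split => w /=; rewrite in_itv/= andbT.
  by apply: measurableT_comp => //; exact: g.1.
have V : ('V_P[fun w => (Z u w - Z v w)%R] <= (C * a ^+ k)%:E)%E.
  rewrite (variance_increment Z_gaussian)// lee_fin (le_trans (k_bound Iu Iv))//.
  rewrite ler_pM2l// ge_max -[a ^+ k](powR_exprAC _ _ (ltW half_gt0)).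
  have mono (s x y : R) : 0 < s -> 0 <= x -> x <= y -> x `^ s <= y `^ s.
    move=> s0 x0 xy; rewrite ge0_ler_powR ?nnegrE// ?(ltW s0)//.
    exact: le_trans xy.
  apply/andP; split; first exact: mono.
  (* Here the refined mesh pays off: [alpha1 <= r * alpha2] brings the second term of the maximum
     below [a ^+ k] too. *)
  apply: (le_trans (mono _ _ _ alpha2_gt0 (normr_ge0 _) uv2)).
  rewrite !powR_exprAC ?(ltW half_gt0)// exprM lerXn2r ?nnegrE ?exprn_ge0 ?powR_ge0//.
  rewrite -powR_mulrn ?powR_ge0// -powRrM mulrC.
  by move: r_alpha; rewrite le_eqVlt => /predU1P[->//|/powR_half_lt/ltW].
have Ca : 0 < C * a ^+ k by rewrite mulr_gt0// exprn_gt0.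
have bk : 0 <= b ^+ k by rewrite exprn_ge0// ltW.
have <- : (b ^+ k) ^+ 2 / (2048 * (C * a ^+ k)) = q ^+ k / (2048 * C).
  rewrite /q expr_div_n -!exprM mulnC; move: (b ^+ _) => B.
  by rewrite mulrA (invfM (2048 * C)) [X in B * X]mulrC mulrA.
exact: (gaussian_rv_tail g (centred_increment Z_gaussian Z_centred Iu Iv) Ca V bk).
Qed.

Lemma gaussian_modulus : {ae P, forall w, exists (m : nat) (K : R),
  forall k, (m <= k)%N -> forall u v, I u -> I v -> aniso_close r k u v ->
    `|Z u w - Z v w| <= K * b ^+ k}.
Proof.
have [I0|/set0P[p0 Ip0]] := eqVneq I set0.
  by apply: aeW => w; exists 0%N, 0 => k _ u v; rewrite I0.
have [net [net_I net_close [B [A size_net]]]] := net_exists r_gt0 I_bounded.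
have [S [S_countable SI IS sepZ]] := Z_separable.
(* If the separating set is empty, the constant sequence [p0] serves. *)
have [e eS] : exists e : nat -> 'rV[R]_n * R,
    (forall i, I (e i)) /\ (forall s, S s -> exists i, e i = s).
  have [->|[e]] := pfcard_geP S_countable.
    by exists (fun=> p0); split.
  exists e; split => [i|s Ss]; first exact/SI/funS.
  by have [i _ <-] := 'surj_e Ss; exists i.
(* Adding the first k points of the separating sequence to the k-th net makes
   the chain from any of these points finite. *)
pose V k := net k ++ [seq e i | i <- iota 0 k].
pose W k := V k.+1 ++ V k.+2.
have VI k u : u \in V k -> I u.
  by rewrite mem_cat => /orP[/net_I//|/mapP[i _ ->]]; exact: eS.1.
have WI k u : u \in W k -> I u by rewrite mem_cat => /orP[] /VI.
have expn_le x y j : (x <= y -> x ^ j <= y ^ j)%N.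
  by case: j => // j; rewrite leq_exp2r.
(* The base [A + 2] dominates both the net and, through [k < 2 ^ k], the [k] added points. *)
have size_V k : (size (V k) <= B.+1 * (A + 2) ^ k)%N.
  rewrite size_cat size_map size_iota mulSn addnC leq_add//.
    by rewrite (leq_trans (ltnW (ltn_expl k (isT : 1 < 2)%N)))// expn_le// leq_addl.
  by rewrite (leq_trans (size_net k))// leq_mul2l expn_le ?leq_addr ?orbT.
have [N [X size_W]] : exists N X : nat, forall k, (size (W k) ^ 2 <= N * X ^ k)%N.
  exists ((2 * B.+1 * (A + 2) ^ 2) ^ 2)%N, ((A + 2) ^ 2)%N => k.
  rewrite expnAC -expnMn leq_exp2r// size_cat.
  rewrite (leq_trans (leq_add (size_V _) (size_V _)))//.
  rewrite -mulnDr -[leqRHS]mulnA -expnD [(2 * _)%N]mulnC -[leqRHS]mulnA leq_mul2l/=.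
  by rewrite mul2n -addnn leq_add// leq_exp2l ?addn2// add2n.
have A0 : 0 <= X%:R :> R by [].
have c0 : 0 < 2048 * C by have := C_gt0; lra.
have [M' M'0 HM] := expR_superexponential A0 q_gt1 c0.
pose eps k := 4 * expR (- (q ^+ k / (2048 * C))).
have eps0 k : 0 <= eps k by rewrite mulr_ge0 ?expR_ge0.
have W_eps k : (size (W k) ^ 2)%:R * eps k <= N%:R * 4 * M' * 2^-1 ^+ k.
  apply: (@le_trans _ _ ((N * X ^ k)%:R * eps k)).
    by rewrite ler_wpM2r// ler_nat size_W.
  rewrite natrM natrX /eps mulrACA -[leRHS]mulrA ler_wpM2l// mulr_ge0//.
have NM0 : 0 <= N%:R * 4 * M' by rewrite !mulr_ge0.
have := borel_cantelli_pairs NM0 eps0 W_eps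
  (fun k u v uW vW => close_tail (WI k u uW) (WI k v vW)).
apply: filterS2 sepZ => w sepw [m Hm].
(* Four levels are lost, two to [chaining] and two to [separable_modulus]; [b ^+ 4] in the
   denominator makes up for them. *)
exists (m + 4)%N, (3 / (b ^+ 4 * (1 - b))) => k mk u v Iu Iv uv.
have [j kj] : exists j, k = j.+4.
  by exists (k - 4)%N; rewrite -addn4 subnK// (leq_trans (leq_addl m 4)).
have mj : (m <= j)%N by move: mk; rewrite kj addn4.
rewrite kj in uv *.
have -> : 3 / (b ^+ 4 * (1 - b)) * b ^+ j.+4 = 3 * b ^+ j / (1 - b).
  by rewrite -(addn4 j) exprD; field; rewrite subr_eq0 !gt_eqF.
have sym := @aniso_close_sym R n r.
have trans i x y z := @aniso_close_trans R n r i x y z r_gt0.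
have refl := @aniso_close_refl R n r.
apply: (separable_modulus (k := j.+2) sym trans (@nbhs_aniso_close R n r) sepw) => //.
move=> s s' Ss Ss' ss'.
apply: (@chaining R _ _ b refl sym trans b_gt0 b_lt1 S
  (fun i => [set` V i]) (Z^~ w) m _ _ _ s s' j) => //.
- move=> i p Sp; have [x xi px] := net_close i p (SI _ Sp).
  by exists x => //=; rewrite mem_cat xi.
- move=> p Sp; have [i <-] := eS.2 _ Sp; exists i.+1 => l il /=.
  by rewrite mem_cat map_f ?orbT// mem_iota add0n.
- move=> i x y mi xW yW; apply: (Hm i mi);
    by rewrite mem_cat; apply/orP.
Qed.

End modulus.

(** * The logistic density transformation *)

Section hoelder_of_modulus.
Context {R : realType} {n : nat}.
Variables (D : set 'rV[R]_n) (T : set R) (f : 'rV[R]_n * R -> R).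
Variables (beta K : R) (r m : nat).
Hypothesis beta_gt0 : 0 < beta.

(** Points farther apart than [2^-1 ^+ m] are handled by boundedness. Closer distinct points lie
    between two consecutive dyadic scales, and passing from one scale to the other costs the factor
    [1 / b]. *)
Lemma hoelder_of_modulus : [bounded f p | p in D `*` T] ->
  (forall k, (m <= k)%N -> forall u v, (D `*` T) u -> (D `*` T) v ->
    aniso_close r k u v -> `|f u - f v| <= K * (2^-1 `^ beta) ^+ k) ->
  exists2 L, 0 <= L & forall x x' t, D x -> D x' -> T t ->
    `|f (x, t) - f (x', t)| <= L * `|x - x'| `^ beta.
Proof.
move=> [B0 [_ /(_ (B0 + 1))]]; rewrite ltrDl ltr01 => /(_ isT).
set B := B0 + 1 => fB modf.
have b0 : 0 < 2^-1 `^ beta :> R by rewrite powR_gt0 ?invr_gt0.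
set b := 2^-1 `^ beta in b0 modf.
have bE k : (2^-1 ^+ k) `^ beta = b ^+ k :> R by rewrite powR_exprAC ?invr_ge0.
have b_gt k : 0 < b ^+ k by rewrite exprn_gt0.
exists (`|K| / b + 2 * `|B| / b ^+ m).
  by rewrite addr_ge0// divr_ge0 ?mulr_ge0 ?exprn_ge0 ?(ltW b0).
move=> x x' t Dx Dx' Tt.
have [->|xx'] := eqVneq x x'.
  by rewrite !subrr !normr0 mulr_ge0 ?powR_ge0// addr_ge0// divr_ge0 ?mulr_ge0 ?exprn_ge0 ?(ltW b0).
have h0 : 0 < `|x - x'| by rewrite normr_gt0 subr_eq0.
have pw k : 2^-1 ^+ k < `|x - x'| -> b ^+ k <= `|x - x'| `^ beta.
  move=> kx; rewrite -bE ge0_ler_powR ?nnegrE ?exprn_ge0 ?invr_ge0 ?(ltW kx)//.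
  exact: ltW.
have KL : 0 <= `|K| / b by rewrite divr_ge0 ?(ltW b0).
have BL : 0 <= 2 * `|B| / b ^+ m by rewrite divr_ge0 ?mulr_ge0 ?(ltW (b_gt m)).
have [mx|xm] := ltP (2^-1 ^+ m) `|x - x'|.
  rewrite mulrDl (le_trans (ler_normB _ _))//.
  apply: ler_wpDl; first by rewrite mulr_ge0 ?powR_ge0.
  apply: (@le_trans _ _ (2 * `|B| / b ^+ m * b ^+ m)); last by rewrite ler_wpM2l ?pw.
  rewrite divfK ?gt_eqF// mulr_natl mulr2n.
  by rewrite lerD// (le_trans (fB _ _)) ?ler_norm.
have ex : exists k, 2^-1 ^+ k.+1 < `|x - x'|.
  exists (Num.truncn `|x - x'|^-1).
  rewrite exprVn invf_plt ?posrE ?exprn_gt0//.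
  rewrite (lt_le_trans (truncnS_gt _))// -natrX ler_nat ltnW//.
  exact: ltn_expl.
case: (ex_minnP ex) => k kx kmin.
have mk : (m <= k)%N.
  rewrite leqNgt; apply/negP => km; move: (lt_le_trans kx xm).
  by rewrite ltNge ler_wiXn2l ?invr_ge0 ?invf_le1 ?ler1n.
have xk : `|x - x'| <= 2^-1 ^+ k.
  (* Minimality says nothing at [k = 0]; there [m = 0] and the bound is [xm]. *)
  case: k kmin mk {kx} => [|k] kmin mk; first by move: mk xm; rewrite leqn0 => /eqP ->.
  by rewrite leNgt; apply/negP => /kmin; rewrite ltnn.
rewrite mulrDl; apply: ler_wpDr; first by rewrite mulr_ge0 ?powR_ge0.
apply: (le_trans (modf k mk (x, t) (x', t) _ _ _)) => //.
  by split => //=; rewrite subrr normr0 exprn_ge0 ?invr_ge0.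
apply: (@le_trans _ _ (`|K| / b * b ^+ k.+1)); last by rewrite ler_wpM2l ?pw.
by rewrite exprS mulrA divfK ?gt_eqF// ler_wpM2r ?ler_norm ?(ltW (b_gt k)).
Qed.

End hoelder_of_modulus.

Section logistic.
Context {R : realType} {n : nat}.
Variables (D : set 'rV[R]_n) (T : set R) (f : 'rV[R]_n * R -> R).
Hypotheses (T_compact : compact T) (T_pos : (0 < lebesgue_measure T)%E).
Hypothesis f_measurable : forall x, D x -> measurable_fun T (fun t => f (x, t)).
Hypothesis f_bounded : [bounded f p | p in D `*` T].

Let mT : measurable T.
Proof. by apply: closed_measurable; apply: compact_closed => //; exact: Rhausdorff. Qed.

Let T_fin : (lebesgue_measure T < +oo)%E. Proof. exact: compact_finite_measure. Qed.

Let lT := fine (lebesgue_measure T).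

Let lT_gt0 : 0 < lT. Proof. by rewrite fine_gt0// T_pos T_fin. Qed.

Let f_bound : exists2 B : R, 0 <= B & forall x t, D x -> T t -> `|f (x, t)| <= B.
Proof.
have [B0 [_ /(_ (`|B0| + 1))]] := f_bounded.
rewrite (le_lt_trans (ler_norm B0)) ?ltrDl// => /(_ isT) fB.
by exists (`|B0| + 1); [rewrite addr_ge0|move=> x t Dx Tt; exact: fB].
Qed.

Let J x := \int[lebesgue_measure]_(u in T) expR (f (x, u)).

Let expf_measurable x : D x -> measurable_fun T (fun t => expR (f (x, t))).
Proof. by move=> Dx; apply: measurableT_comp => //; exact: f_measurable. Qed.

Let expf_integrable x : D x ->
  lebesgue_measure.-integrable T (EFin \o (fun t => expR (f (x, t)))).
Proof.
move=> Dx; have [B B0 fB] := f_bound.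
apply: measurable_bounded_integrable => //; first exact: expf_measurable.
exists (expR B); split; first exact: num_real.
move=> y By t Tt /=; rewrite ger0_norm ?expR_ge0// (le_trans _ (ltW By))// ler_expR.
exact: le_trans (ler_norm _) (fB _ _ Dx Tt).
Qed.

Let cst_integrable (c : R) : lebesgue_measure.-integrable T (EFin \o (fun=> c)).
Proof.
apply: measurable_bounded_integrable => //.
by exists `|c|; split => // y cy t _ /=; exact: ltW.
Qed.

(** The bound is uniform in [x], so that a single constant controls the quotient on all of [D]. *)
Let J_ge x B : D x -> (forall x t, D x -> T t -> `|f (x, t)| <= B) ->
  expR (- B) * lT <= J x.
Proof.
move=> Dx fB; rewrite -Rintegral_cst//.
apply: le_Rintegral => //; first exact: expf_integrable.
by move=> t Tt; rewrite ler_expR; have := fB _ _ Dx Tt; rewrite ler_norml => /andP[].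
Qed.

Let J_gt0 x : D x -> 0 < J x.
Proof.
move=> Dx; have [B B0 fB] := f_bound.
by rewrite (lt_le_trans _ (J_ge Dx fB))// mulr_gt0 ?expR_gt0.
Qed.

Lemma logistic_density_pdf x : D x -> positive_pdf T (logistic_density T f x).
Proof.
move=> Dx; split.
- by apply: measurable_funM => //; exact: expf_measurable.
- by move=> t Tt; rewrite divr_gt0 ?expR_gt0// J_gt0.
- under eq_integral do rewrite /logistic_density EFinM.
  rewrite integralZr//; last exact: expf_integrable.
  have -> : (\int[lebesgue_measure]_(t in T) (expR (f (x, t)))%:E)%E = (J x)%:E.
    by rewrite fineK//; apply: integrable_fin_num => //; exact: expf_integrable.
  by rewrite -EFinM divff// gt_eqF// J_gt0.
Qed.

Let expR_lipschitz (B y z : R) : `|y| <= B -> `|z| <= B ->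
  `|expR y - expR z| <= expR B * `|y - z|.
Proof.
wlog yz : y z / z <= y.
  move=> H yB zB; have [zy|/ltW yz] := leP z y; first exact: H.
  by rewrite distrC (distrC y) H.
move=> yB _; rewrite !ger0_norm ?subr_ge0 ?ler_expR//.
apply: (@le_trans _ _ (expR y * (y - z))).
  have -> : expR z = expR y * expR (z - y) by rewrite -expRD addrC subrK.
  by rewrite -{1}[expR y]mulr1 -mulrBr ler_pM2l ?expR_gt0//;
    have := expR_ge1Dx (z - y); lra.
by rewrite ler_wpM2r ?subr_ge0// ler_expR (le_trans (ler_norm _)).
Qed.

Lemma logistic_density_hoelder (beta L : R) : 0 <= L ->
  (forall x x' t, D x -> D x' -> T t ->
    `|f (x, t) - f (x', t)| <= L * `|x - x'| `^ beta) ->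
  hoelder_supnorm D T beta (logistic_density T f).
Proof.
move=> L0 fL; have [B B0 fB] := f_bound.
pose c := expR (- B) * lT.
have c0 : 0 < c by rewrite mulr_gt0 ?expR_gt0.
exists (expR B * L / c + expR B * (expR B * L * lT) / (c * c)) => x x' Dx Dx'.
pose h := `|x - x'| `^ beta; have h0 : 0 <= h by exact: powR_ge0.
have expf t : T t -> `|expR (f (x, t)) - expR (f (x', t))| <= expR B * (L * h).
  move=> Tt; rewrite (le_trans (expR_lipschitz (fB _ _ Dx Tt) (fB _ _ Dx' Tt)))//.
  by rewrite ler_pM2l ?expR_gt0// fL.
have iB : lebesgue_measure.-integrable T
    (EFin \o (fun u => expR (f (x, u)) - expR (f (x', u)))).
  have := integrableB _ (expf_integrable Dx) (expf_integrable Dx').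
  by apply; exact: mT.
have Jh : `|J x - J x'| <= expR B * (L * h) * lT.
  rewrite /J -RintegralB ?expf_integrable//.
  rewrite (le_trans (le_normr_Rintegral _ iB))// -Rintegral_cst//.
  by apply: le_Rintegral => //; exact: integrable_norm iB.
have cJ := J_ge Dx fB; have cJ' := J_ge Dx' fB.
have J0 := J_gt0 Dx; have J0' := J_gt0 Dx'.
apply: ge_ereal_sup => _ [t Tt <-]; rewrite lee_fin -/h /logistic_density -/(J x) -/(J x').
(* The change of the numerator and the change of the normaliser are separated; they yield the two
   summands of the Hoelder constant. *)
have -> : expR (f (x, t)) / J x - expR (f (x', t)) / J x' =
  (expR (f (x, t)) - expR (f (x', t))) / J x -
  expR (f (x', t)) * (J x - J x') / (J x * J x').
  by field; rewrite !gt_eqF.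
rewrite (le_trans (ler_normB _ _))// [leRHS]mulrDl lerD//.
  rewrite normrM [`|_^-1|]ger0_norm ?invr_ge0 ?(ltW J0)//.
  rewrite [leRHS]mulrAC ler_pM ?invr_ge0 ?(ltW J0)//.
    by rewrite -mulrA expf.
  by rewrite lef_pV2 ?posrE.
rewrite !normrM [`|_^-1|]ger0_norm ?invr_ge0 ?mulr_ge0 ?(ltW J0) ?(ltW J0')//.
rewrite [leRHS]mulrAC ler_pM ?invr_ge0 ?mulr_ge0 ?(ltW J0) ?(ltW J0')//.
  rewrite -[leRHS]mulrA [`|expR _|]ger0_norm ?expR_ge0// ler_pM ?expR_ge0//.
    by rewrite ler_expR (le_trans (ler_norm _))// fB.
  by rewrite (le_trans Jh)// mulrA mulrAC.
rewrite lef_pV2 ?posrE; last 2 first.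
- by rewrite mulr_gt0.
- by rewrite mulr_gt0.
by rewrite ler_pM// ltW.
Qed.

End logistic.

Lemma compact_norm_le {R : realType} {V : normedModType R} (A : set V) :
  compact A -> exists M : nat, forall x, A x -> `|x| <= M%:R.
Proof.
move=> /compact_bounded[M0 [_ /(_ (Num.truncn `|M0|).+1%:R)]].
rewrite (le_lt_trans (ler_norm M0)) ?truncnS_gt// => /(_ isT) AM.
by exists (Num.truncn `|M0|).+1 => x Ax; exact: AM.
Qed.

(** * Measurability of the path sections and of the random density *)

Section measurability.
Context {R : realType} {d : measure_display} {Omega : measurableType d} {n : nat}.
Variables (D : set 'rV[R]_n) (T : set R) (Z : 'rV[R]_n * R -> Omega -> R).
Hypotheses (D_compact : compact D) (T_compact : compact T).
Hypothesis Z_measurable : measurable_process (D `*` T) Z.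

Let mT : measurable T.
Proof. by apply: closed_measurable; apply: compact_closed => //; exact: Rhausdorff. Qed.

Let mD : measurable (D : set (borel_rV R n)).
Proof.
rewrite -[D]setCK; apply: measurableC; apply: sub_sigma_algebra.
by apply: closed_openC; apply: compact_closed => //; exact: norm_hausdorff.
Qed.

(** Compactness makes the index set Borel, which gives [Z_measurable] its content. *)
Let mDT : measurable ((D `*` T `*` setT) : set (borel_rV R n * R * Omega)%type).
Proof. by apply: measurableX => //; exact: measurableX. Qed.

Lemma measurable_process_section x w : D x ->
  measurable_fun T (fun t => Z (x, t) w).
Proof.
move=> Dx.
apply: (measurable_comp mDT _ Z_measurable
  (g := fun t : R => ((x : borel_rV R n, t), w))).
  by move=> _ [t Tt <-].
by apply: measurable_funTS; exact: measurable_fun_pair.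
Qed.

Let measurable_expZ x : D x ->
  measurable_fun (setT `*` T) (fun q : Omega * R => expR (Z (x, q.2) q.1)).
Proof.
move=> Dx; apply: measurableT_comp => //.
apply: (measurable_comp mDT _ Z_measurable
  (g := fun q : Omega * R => ((x : borel_rV R n, q.2), q.1))).
  by move=> _ [[w t] [_ Tt] <-].
apply: measurable_funTS; apply: measurable_fun_pair => //.
by apply: measurable_fun_pair.
Qed.

Lemma measurable_logistic_density x t : D x -> T t ->
  measurable_fun setT (fun w => logistic_density T (Z^~ w) x t).
Proof.
move=> Dx Tt; rewrite /logistic_density.
apply: measurable_funM.
  apply: measurableT_comp => //.
  apply: (measurable_comp mDT _ Z_measurable
    (g := fun w : Omega => ((x : borel_rV R n, t), w))).
    by move=> _ [w _ <-].
  by apply: measurable_fun_pair.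
pose J w := \int[lebesgue_measure]_(u in T) expR (Z (x, u) w).
(* The inverse of the nonnegative [J w] is written as a power to use [measurable_powR]. *)
apply: (eq_measurable_fun (fun w => J w `^ (-1))) => [w _|].
  by rewrite powR_inv1// Rintegral_ge0// => u _; exact: expR_ge0.
apply: (measurableT_comp (measurable_powR _)).
apply: (measurableT_comp (fine_measurable measurableT)).
(* Tonelli's theorem is applied to the extension of the integrand by 0 off [T], which is measurable
   on the whole product. *)
pose g (q : Omega * R) := (expR (Z (x, q.2) q.1))%:E.
have mg : measurable_fun setT (g \_ (setT `*` T)).
  apply/(measurable_restrictT _ _).1; first exact: measurableX.
  by apply/measurable_EFinP; exact: measurable_expZ.
have g0 q : (0 <= (g \_ (setT `*` T)) q)%E.
  by apply: erestrict_ge0 => q' _; rewrite lee_fin expR_ge0.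
have := @measurable_fun_fubini_tonelli_F _ _ Omega (measurableTypeR R) R lebesgue_measure _ mg g0.
apply: eq_measurable_fun => w _.
rewrite /fubini_F [RHS]integral_mkcond; apply: eq_integral => u _.
rewrite !patchE /g.
have -> : ((w, u) \in setT `*` T) = (u \in T) by rewrite in_setX in_setT.
by [].
Qed.

End measurability.

Theorem theorem3p3 (R : realType) (d : measure_display)
    (Omega : measurableType d) (P : probability Omega R)
    (n : nat) (n_gt0 : (0 < n)%N)
    (D : set 'rV[R]_n) (D_compact : compact D)
    (D_convex : @convex_set R 'rV[R]_n D)
    (T : set R) (T_compact : compact T) (T_convex : @convex_set R R^o T)
    (T_pos : (0 < lebesgue_measure T)%E)
    (Z : 'rV[R]_n * R -> Omega -> R)
    (Z_measurable : measurable_process (D `*` T) Z)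
    (Z_separable : separable_process P (D `*` T) Z)
    (Z_gaussian : gaussian_process P (D `*` T) Z)
    (Z_centred : centred_process P (D `*` T) Z)
    (Z_bounded : bounded_paths (D `*` T) Z)
    (C alpha1 alpha2 : R)
    (C_gt0 : 0 < C) (alpha1_gt0 : 0 < alpha1) (alpha2_gt0 : 0 < alpha2)
    (k_bound : let k := covariance_kernel P Z in
      forall (x x' : 'rV[R]_n) (t t' : R), D x -> D x' -> T t -> T t' ->
      k (x, t) (x, t) + k (x', t') (x', t') - 2 * k (x, t) (x', t') <=
      C * Num.max (`|x - x'| `^ alpha1) (`|t - t'| `^ alpha2)) :
  let Y := fun w : Omega => logistic_density T (fun p => Z p w) in
  [/\ forall (x : 'rV[R]_n) (t : R), D x -> T t ->
        measurable_fun setT (fun w : Omega => Y w x t),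
      forall (w : Omega) (x : 'rV[R]_n), D x -> positive_pdf T (Y w x) &
      forall beta : R, 0 < beta -> beta < alpha1 / 2 ->
        {ae P, forall w : Omega, hoelder_supnorm D T beta (Y w)}].
Proof.
move=> Y; split.
- move=> x t Dx Tt; exact: (measurable_logistic_density D_compact T_compact Z_measurable).
- move=> w x Dx; apply: (logistic_density_pdf (D := D)) => // y Dy.
  exact: (measurable_process_section D_compact T_compact Z_measurable).
- move=> beta beta_gt0 beta_lt.
  have [MD MDP] := compact_norm_le D_compact.
  have [MT MTP] := @compact_norm_le R R^o T T_compact.
  (* The successor makes [r] positive and at least [alpha1 / alpha2]. *)
  pose r := (Num.truncn (alpha1 / alpha2)).+1.
  have r_alpha : alpha1 <= r%:R * alpha2.
    by rewrite -ler_pdivrMr// ltW// truncnS_gt.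
  have I_bounded (p : 'rV[R]_n * R) : (D `*` T) p ->
      `|p.1| <= (maxn MD MT)%:R /\ `|p.2| <= (maxn MD MT)%:R.
    move=> [Dp Tp]; split.
      by rewrite (le_trans (MDP _ Dp))// ler_nat leq_maxl.
    by rewrite (le_trans (MTP _ Tp))// ler_nat leq_maxr.
  have kb p q : (D `*` T) p -> (D `*` T) q ->
      covariance_kernel P Z p p + covariance_kernel P Z q q -
        2 * covariance_kernel P Z p q <=
      C * Num.max (`|p.1 - q.1| `^ alpha1) (`|p.2 - q.2| `^ alpha2).
    by case: p q => [x t] [x' t'] [Dx Tt] [Dx' Tt']; exact: k_bound.
  have := gaussian_modulus Z_separable Z_gaussian Z_centred C_gt0 alpha1_gt0
    alpha2_gt0 kb beta_gt0 beta_lt (isT : 0 < r)%N r_alpha I_bounded.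
  apply: filterS => w [m [K modw]].
  have [L L0 ZL] := hoelder_of_modulus beta_gt0 (Z_bounded w) modw.
  apply: logistic_density_hoelder L0 ZL => // x Dx.
  exact: (measurable_process_section D_compact T_compact Z_measurable).
Qed.
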